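(* Let $X$ be a super-reflexive Banach space and let $Q$ be a non-zero quasi-nilpotent operator on $X$ which satisfies property $(\star)$. Then $Q$ has a non-trivial hyperinvariant subspace.
   Context: Banach spaces are over $\mathbb{R}$ or $\mathbb{C}$. ''Operator'' means continuous linear map, ''subspace'' means closed linear subspace, and a subspace of $X$ is ''non-trivial'' if it is different from $\{0\}$ and from $X$. For an operator $Q$ on $X$, $\{Q\}'$ denotes the commutant of $Q$, i.e. the set of all operators $T$ on $X$ with $TQ=QT$. A subspace is hyperinvariant for $Q$ if it is invariant under every $T\in\{Q\}'$. The operator $Q$ is quasi-nilpotent if $\lim_{n\to\infty}\|Q^n\|^{1/n}=0$. A Banach space $X$ is super-reflexive if every infinite dimensional Banach space $Y$ which is finitely represented in $X$ is reflexive. For $x\in X$ and $\varepsilon>0$, $S(x,\varepsilon)=\{y\in X:\|x-y\|=\varepsilon\}$. Property $(\star)$: an operator $Q$ on a Banach space $X$ satisfies property $(\star)$ if for every $\varepsilon\in(0,1)$ there exists $x_0\in S(0,1)$ such that for every weakly convergent sequence $(x_n)\subset S(x_0,\varepsilon)$ there exist a subsequence $(x_{n_k})_k$ of $(x_n)$ and a sequence $(K_k)_k\subset\{Q\}'$ such that (a) $\|K_k\|\le 1$ and $\|K_k(x_0)\|\ge \frac{1+\varepsilon}{2}$ for all $k\in\mathbb{N}$, and (b) the sequence $(K_k(x_{n_k}))_k$ converges in norm. *)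

(* Defs.v *)
From HB Require Import structures.
From mathcomp Require Import all_boot all_order all_algebra.
From mathcomp Require Import all_classical all_reals.
From mathcomp Require Import topology normedtype sequences.
From mathcomp Require Export complex.

Set Implicit Arguments.
Unset Strict Implicit.
Unset Printing Implicit Defensive.

Import Order.TTheory GRing.Theory Num.Theory.
Import numFieldNormedType.Exports.

Local Open Scope classical_set_scope.
Local Open Scope ring_scope.

(* The definitions are generic in the scalar field [K : numFieldType] but are
   meant for [K] the reals [R] or the complex numbers [R[i]] with [R : realType].
   As usual in the library, the norm of a [K]-normed module is [K]-valued, and
   [a <= b] in [R[i]] forces [b - a] to be a nonnegative real: so [0 < e] implies
   that [e] is real, and the supremum in [R[i]] of a nonempty bounded set of real
   numbers is its usual real supremum. *)

Section NormedSpaces.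
Context {K : numFieldType}.

(* Only meaningful for bounded [T]: [supremum] is 0 on unbounded sets. *)
Definition opnorm (X Y : normedModType K) (T : X -> Y) : K :=
  supremum 0 [set `|T x| | x in [set x : X | `|x| <= 1]].

(* The nonnegative [n]-th root of [a], for [0 <= a] and [0 < n]. *)
Definition nthroot (n : nat) (a : K) : K :=
  xget 0 [set r : K | 0 <= r /\ r ^+ n = a].

Definition sphere (X : normedModType K) (x : X) (e : K) : set X :=
  [set y | `|x - y| = e].

Definition dual (X : normedModType K) : set (X -> K^o) :=
  [set f | linear f /\ continuous f].

Definition weakly_convergent (X : normedModType K) (x : nat -> X) : Prop :=
  exists l : X, forall f, dual f -> (fun n => f (x n)) @ \oo --> f l.

(* [phi] is an element of the bidual: a bounded linear functional on [dual],
   whose values outside of [dual] are irrelevant. *)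
Definition reflexive_space (X : normedModType K) : Prop :=
  forall phi : (X -> K^o) -> K,
    (forall (a : K) f g, dual f -> dual g ->
       phi (fun x => a *: f x + g x) = a * phi f + phi g) ->
    (exists C : K, forall f, dual f -> `|phi f| <= C * opnorm f) ->
  exists x : X, forall f, dual f -> phi f = f x.

Definition finite_dimensional (X : lmodType K) (F : set X) : Prop :=
  exists (n : nat) (b : 'I_n -> X),
    F = [set \sum_(i < n) a i *: b i | a in [set: 'I_n -> K]].

(* Every finite dimensional subspace of [Y] embeds [l]-isomorphically in [X],
   for every [l > 1]. The values of [T] outside of [F] are irrelevant. *)
Definition finitely_represented (Y X : normedModType K) : Prop :=
  forall F : set Y, finite_dimensional F -> forall l : K, 1 < l ->
  exists T : Y -> X,
    (forall (a : K) u v, F u -> F v -> T (a *: u + v) = a *: T u + T v) /\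
    (forall u, F u -> l^-1 * `|u| <= `|T u| <= l * `|u|).

Definition super_reflexive (X : completeNormedModType K) : Prop :=
  forall Y : completeNormedModType K,
    ~ finite_dimensional [set: Y] -> finitely_represented Y X ->
    reflexive_space Y.

Definition quasi_nilpotent (X : normedModType K) (Q : X -> X) : Prop :=
  (fun n => nthroot n (opnorm (iter n Q))) @ \oo --> (0 : K).

Definition commutant (X : normedModType K) (Q : X -> X) :
    set {linear X -> X} :=
  [set T | continuous T /\ forall x, T (Q x) = Q (T x)].

Definition property_star (X : normedModType K) (Q : X -> X) : Prop :=
  forall e : K, 0 < e < 1 ->
  exists2 x0 : X, sphere 0 1 x0 &
  forall x : nat -> X, (forall n, sphere x0 e (x n)) -> weakly_convergent x ->
  exists (s : nat -> nat) (T : nat -> {linear X -> X}),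
    [/\ {homo s : i j / (i < j)%N},
        forall k, commutant Q (T k),
        forall k, opnorm (T k) <= 1 /\ (1 + e) / 2 <= `|T k x0| &
        cvg ((fun k => T k (x (s k))) @ \oo)].

Definition closed_subspace (X : normedModType K) (M : set X) : Prop :=
  [/\ closed M, M 0 & forall (a : K) u v, M u -> M v -> M (a *: u + v)].

Definition hyperinvariant (X : normedModType K) (Q : X -> X) (M : set X) :
    Prop :=
  forall T, commutant Q T -> forall x, M x -> M (T x).

Definition has_nontrivial_hyperinvariant_subspace (X : normedModType K)
    (Q : X -> X) : Prop :=
  exists M : set X,
    [/\ closed_subspace M, hyperinvariant Q M, M <> [set 0] & M <> [set: X]].

End NormedSpaces.

(* Main.v *)
(* Troitsky's method of minimal vectors. If [Q] has dense range, choose for every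
   [n] an almost shortest [y_n] with [|x0 - Q^n y_n| = 1/2]. Separating the ball
   around [x0] from the image under [Q^n] of a ball gives uniformly bounded
   functionals [g_n] with [|g_n x0| >= 1] and [|g_n (Q^n z)| <= 2 |z| / |y_n|].
   Quasi-nilpotence makes [|y_n| / |y_(n+1)|] tend to 0 along a subsequence; by
   reflexivity and property (star), after passing to a further subsequence, there
   are contractions [T_n] in the commutant such that [T_n (Q^n y_n)] converges to
   some [w], and [w <> 0] because [|T_n x0| >= 3/4]. For [S] in the commutant,
   [g_(n+1) (Q S T_n Q^n y_n) = g_(n+1) (Q^(n+1) (S T_n y_n))] tends to 0, so [w]
   lies in the closed hyperinvariant subspace of all [v] with
   [g_(n+1) (Q S v) -> 0] for every such [S]. This subspace is proper since [x0]
   is a limit of vectors [Q v]. *)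

Require Import Defs.
From HB Require Import structures.
From mathcomp Require Import all_boot all_order all_algebra.
From mathcomp Require Import all_classical all_reals.
From mathcomp Require Import topology normedtype sequences.
From mathcomp Require Import exp ring lra.

Set Implicit Arguments.
Unset Strict Implicit.
Unset Printing Implicit Defensive.

Import Order.TTheory GRing.Theory Num.Theory.
Import numFieldNormedType.Exports.

Local Open Scope classical_set_scope.
Local Open Scope ring_scope.

Lemma linear_fun0 (K : nzRingType) (V W : lmodType K) (f : V -> W) :
  linear f -> f 0 = 0.
Proof.
by move=> lf; have := lf (-1) 0 0; rewrite scaler0 addr0 scaleN1r addNr.
Qed.

(** * Infima of sets of real numbers *)

Section Infima.
Context {R : realType}.
Implicit Types (A B : set R) (m : R).

Lemma le_inf_lb A m : A !=set0 -> (forall a, A a -> m <= a) -> m <= inf A.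
Proof. by move=> A0 mA; apply: lb_le_inf. Qed.

Lemma inf_le_mem A m a : (forall a, A a -> m <= a) -> A a -> inf A <= a.
Proof. by move=> mA; apply: ge_inf; exists m. Qed.

Lemma le_infD A B m : A !=set0 -> B !=set0 ->
  (forall a b, A a -> B b -> m <= a + b) -> m <= inf A + inf B.
Proof.
move=> A0 B0 mAB; rewrite -lerBlDl; apply: le_inf_lb => // b Bb.
rewrite lerBlDl -lerBlDr; apply: le_inf_lb => // a Aa.
by rewrite lerBlDr mAB.
Qed.

End Infima.

(** * The Hahn-Banach theorem for sublinear functionals on real vector spaces *)

Section HahnBanachReal.
Context {R : realType} {V : lmodType R}.
Implicit Types (p q : V -> R) (x y v : V).

Definition sublinear p : Prop :=
  (forall x y, p (x + y) <= p x + p y) /\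
  (forall t x, 0 <= t -> p (t *: x) = t * p x).

(** One inequality for [t > 0] suffices: applied to [t^-1] and [t *: x], it yields the reverse
    one. *)
Lemma sublinearI p : (forall x y, p (x + y) <= p x + p y) -> p 0 = 0 ->
  (forall t x, 0 < t -> p (t *: x) <= t * p x) -> sublinear p.
Proof.
move=> pD p0 pZ; split=> // t x; rewrite le_eqVlt => /predU1P[<-|t0].
  by rewrite scale0r mul0r.
apply/le_anti/andP; split; first exact: pZ.
have := pZ t^-1 (t *: x); rewrite invr_gt0 scalerA mulVf ?gt_eqF// scale1r.
by move=> /(_ t0); rewrite -ler_pdivlMl ?invr_gt0// invrK.
Qed.

Lemma sublinear_geN p x : sublinear p -> - p (- x) <= p x.
Proof.
move=> [pD pZ]; have := pD (- x) x; rewrite addNr.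
by have := pZ 0 0 (lexx _); rewrite scale0r mul0r => -> h; lra.
Qed.

(** For sublinear [p] this is the largest sublinear functional below [p] whose value at [- v] is at
    most [- p v]. A functional that no such push can lower is additive. *)
Definition push p v x : R :=
  inf [set p (x + t *: v) - t * p v | t in [set t | 0 <= t]].

Section Push.
Context (p : V -> R) (v : V) (sp : sublinear p).

Let push_lb x a :
  [set p (x + t *: v) - t * p v | t in [set t | 0 <= t]] a -> - p (- x) <= a.
Proof.
move=> [t /= t0 <-]; have [pD pZ] := sp.
rewrite -pZ//; have := pD (x + t *: v) (- x).
by rewrite addrAC subrr add0r => h; lra.
Qed.

Lemma push_le_at t x : 0 <= t -> push p v x <= p (x + t *: v) - t * p v.
Proof. by move=> t0; apply: inf_le_mem (@push_lb x) _; exists t. Qed.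

Lemma push_le x : push p v x <= p x.
Proof. by have := @push_le_at 0 x (lexx _); rewrite scale0r mul0r addr0 subr0. Qed.

Lemma push_ge m x : (forall t, 0 <= t -> m <= p (x + t *: v) - t * p v) ->
  m <= push p v x.
Proof.
move=> mt; apply: le_inf_lb; last by move=> _ [t t0 <-]; exact: mt.
by exists (p (x + 0 *: v) - 0 * p v), 0 => //=.
Qed.

Lemma push_sublinear : sublinear (push p v).
Proof.
have [pD pZ] := sp; apply: sublinearI.
- move=> x y; apply: le_infD.
  + by exists (p (x + 0 *: v) - 0 * p v), 0 => //=.
  + by exists (p (y + 0 *: v) - 0 * p v), 0 => //=.
  move=> _ _ [s /= s0 <-] [t /= t0 <-].
  have := @push_le_at (s + t) (x + y) (addr_ge0 s0 t0) => /le_trans; apply.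
  have := pD (x + s *: v) (y + t *: v).
  by rewrite scalerDl addrACA => h; lra.
- apply/le_anti/andP; split.
    by apply: le_trans (push_le _) _; have := pZ 0 0 (lexx _); rewrite scale0r mul0r => ->.
  by apply: push_ge => t t0; rewrite add0r pZ// subrr.
- move=> c x c0; rewrite -ler_pdivrMl//; apply: push_ge => t t0.
  rewrite ler_pdivrMl//.
  have ct : 0 <= c * t by rewrite mulr_ge0// ltW.
  apply: le_trans (push_le_at (c *: x) ct) _.
  by rewrite -scalerA -scalerDr (pZ _ _ (ltW c0)) mulrBr mulrA.
Qed.

Lemma push_opp : push p v (- v) <= - p v.
Proof.
have [pD pZ] := sp.
have := @push_le_at 1 (- v) ler01; rewrite scale1r addNr mul1r.
by have := pZ 0 0 (lexx _); rewrite scale0r mul0r => ->; rewrite sub0r.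
Qed.

End Push.

(** Zorn's lemma for the reversed pointwise order. A nonempty chain is bounded by its pointwise
    infimum, which is finite because every member satisfies [q x >= - q (- x) >= - p (- x)]. *)
Lemma minimal_sublinear p : sublinear p -> exists2 q, sublinear q &
  (forall x, q x <= p x) /\
  (forall r, sublinear r -> (forall x, r x <= q x) -> r = q).
Proof.
move=> sp.
pose T := {q | sublinear q /\ forall x, q x <= p x}.
pose le (q r : T) := `[< forall x, sval r x <= sval q x >].
have [||||[q [sq qp]] qmax] := @Zorn T le.
- by move=> q; apply/asboolP.
- move=> q r s /asboolP qr /asboolP rs; apply/asboolP => x.
  exact: le_trans (rs x) (qr x).
- move=> [q hq] [r hr] /asboolP /= qr /asboolP /= rq.
  by apply: eq_exist; apply/funext => x; apply/le_anti; rewrite qr rq.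
- move=> A Atot; have [[q0 Aq0]|A0] := pselect (A !=set0); last first.
    exists (exist _ p (conj sp (fun x => lexx _))) => s As.
    by exfalso; apply: A0; exists s.
  pose V' x := [set sval q x | q in A].
  have lb x a : V' x a -> - p (- x) <= a.
    move=> [[q [sq qp]] /= Aq <-].
    by apply: le_trans (sublinear_geN _ sq); rewrite lerN2.
  have V0 x : V' x !=set0 by exists (sval q0 x), q0.
  pose i x := inf (V' x).
  have ile (q : T) x : A q -> i x <= sval q x.
    by move=> Aq; apply: inf_le_mem (lb x) _; exists q.
  have si : sublinear i.
    apply: sublinearI.
    + move=> x y; apply: le_infD => // _ _ [q Aq <-] [r Ar <-].
      (* The chain is totally ordered, so the smaller of [q] and [r] can be used at both [x] and
         [y], where it is subadditive. *)
      have [/asboolP qr|/asboolP rq] := Atot _ _ Aq Ar.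
      * apply: le_trans (ile _ (x + y) Ar) _.
        by apply: le_trans ((svalP r).1.1 x y) _; rewrite lerD2r qr.
      * apply: le_trans (ile _ (x + y) Aq) _.
        by apply: le_trans ((svalP q).1.1 x y) _; rewrite lerD2l rq.
    + apply/le_anti/andP; split.
        apply: le_trans (ile _ 0 Aq0) _.
        by have := (svalP q0).1.2 0 0 (lexx _); rewrite scale0r mul0r => ->.
      apply: le_inf_lb => // _ [q Aq <-].
      by have := (svalP q).1.2 0 0 (lexx _); rewrite scale0r mul0r => ->.
    + move=> t x t0; rewrite -ler_pdivrMl//; apply: le_inf_lb => // _ [q Aq <-].
      by rewrite ler_pdivrMl// -((svalP q).1.2 _ _ (ltW t0)) ile.
  have ip x : i x <= p x by apply: le_trans (ile _ x Aq0) ((svalP q0).2 x).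
  by exists (exist _ i (conj si ip)) => s As; apply/asboolP => x; exact: ile.
exists q => //; split=> [//|r sr rq].
have rp x : r x <= p x by apply: le_trans (rq x) (qp x).
have := qmax (exist _ r (conj sr rp)) (asboolT rq).
by move=> /(congr1 sval) /= ->.
Qed.

(** A minimal sublinear [q] is linear: [push q v = q] gives [q x <= q (x + v) - q v], the converse
    of subadditivity. *)
Lemma hahn_banach_sublinear p : sublinear p ->
  exists2 f : V -> R, linear f & forall x, f x <= p x.
Proof.
move=> /minimal_sublinear[q sq [qp qmin]]; exists q => //.
have qpush v : push q v = q.
  by apply: qmin; [exact: push_sublinear|exact: push_le].
have [qD' qZ] := sq.
have qD x y : q (x + y) = q x + q y.
  apply/le_anti; rewrite qD'/=.
  by have := @push_le_at _ y sq 1 x ler01; rewrite qpush scale1r mul1r lerBrDr.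
have q0 : q 0 = 0 by have := qZ 0 0 (lexx _); rewrite scale0r mul0r.
have qN x : q (- x) = - q x by apply/eqP; rewrite -addr_eq0 -qD addNr q0.
move=> c x y; rewrite qD; congr (_ + _).
have [c0|/ltW c0] := leP 0 c; first exact: qZ.
by rewrite -[c]opprK scaleNr qN qZ ?oppr_ge0// -mulNr.
Qed.

(** A linear [f] below [push p x0] satisfies [f (- x0) <= - p x0], which forces equality at [x0]. *)
Lemma hahn_banach_real p x0 : sublinear p ->
  exists2 f : V -> R, linear f & (forall x, f x <= p x) /\ f x0 = p x0.
Proof.
move=> sp; have [f lf fp] := hahn_banach_sublinear (push_sublinear x0 sp).
exists f => //; have fpx x : f x <= p x by apply: le_trans (fp x) (push_le _ sp x).
split=> //; apply/le_anti; rewrite fpx/=.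
have := le_trans (fp (- x0)) (push_opp x0 sp).
by have := lf (-1) x0 0; rewrite (linear_fun0 lf) !addr0 !scaleN1r => ->; rewrite lerN2.
Qed.

End HahnBanachReal.

(** * The common interface of the real and complex scalars *)

Section ScalarFields.
Context {R : realType} {K : numFieldType} (i : {rmorphism R -> K}).

Definition seminorm (V : lmodType K) (p : V -> R) : Prop :=
  (forall x y, p (x + y) <= p x + p y) /\
  (forall (a : K) x, i (p (a *: x)) = `|a| * i (p x)).

(* What the argument needs from the scalars, so that it can be run once for
   both the reals and the complex numbers. *)
Record scalar_field : Prop := ScalarField {
  emb_le : {mono i : x y / x <= y};
  emb_surj : forall z : K, 0 <= z -> exists r, z = i r;
  emb_ultra : forall (T : Type) (U : set_system T) (u : T -> K) (C : R),
    UltraFilter U -> (forall t, `|u t| <= i C) ->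
    exists l : K, forall e : R, 0 < e -> U [set t | `|u t - l| <= i e];
  emb_dense : exists q : nat -> K, forall (z : K) (e : R), 0 < e ->
    exists n, `|z - q n| <= i e;
  emb_hb : forall (V : lmodType K) (p : V -> R) (x0 : V), seminorm p ->
    exists2 f : V -> K^o, linear f &
      (forall x, `|f x| <= i (p x)) /\ i (p x0) <= `|f x0|
}.

End ScalarFields.

(** * The real numbers as scalars *)

Section RealScalars.
Context {R : realType}.

Lemma fmap_ultra (T S : Type) (u : T -> S) (U : set_system T) :
  UltraFilter U -> UltraFilter (fmap u U).
Proof.
move=> UU; split=> [|G GG UG]; first exact: fmap_proper_filter.
apply/seteqP; split=> // A GA.
have [//|UA] := in_ultra_setVsetC (u @^-1` A) UU.
have GnA : G (~` A) by apply: UG.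
by have /filter_ex[? []] : G (A `&` ~` A) by exact: filterI.
Qed.

Lemma real_ultra (T : Type) (U : set_system T) (u : T -> R) (C : R) :
  UltraFilter U -> (forall t, `|u t| <= C) ->
  exists l : R, forall e : R, 0 < e -> U [set t | `|u t - l| <= e].
Proof.
move=> UU uC; have := @segment_compact R (- C) C; rewrite compact_ultra.
have uCC : fmap u U `[- C, C]%classic.
  rewrite /fmap/= (_ : _ @^-1` _ = setT); first exact: filterT.
  by apply/seteqP; split=> // t _ /=; rewrite in_itv/= -ler_norml.
move=> /(_ _ (fmap_ultra u UU) uCC)[l [_ ul]].
exists l => e e0.
have /ul : nbhs l [set x | `|x - l| <= e].
  apply/nbhs_ballP; exists e => //= x; rewrite /ball/= distrC => /ltW//.
by [].
Qed.

Lemma rat_approx (z e : R) : 0 < e -> exists q : rat, `|z - ratr q| <= e.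
Proof.
move=> e0; have [|x [zx [q _ qx]]] := @dense_rat R (ball z e) _ (ball_open z e).
  by exists z; exact: ballxx e0.
by exists q; rewrite qx ltW.
Qed.

Lemma real_scalar_field : scalar_field (idfun : {rmorphism R -> R}).
Proof.
split=> //.
- by move=> z _; exists z.
- exact: real_ultra.
(* The rationals are enumerated by decoding; codes of nothing are sent to the default 0. *)
- exists (fun n => ratr (odflt 0 (unpickle n))) => z e /(rat_approx z)[q zq].
  by exists (pickle q); rewrite pickleK.
- move=> V p x0 [pD pZ].
  have p0 : p 0 = 0 by rewrite -(scale0r 0) [LHS]pZ normr0 mul0r.
  have sp : sublinear p.
    by split=> // t x t0; rewrite [LHS]pZ/= ger0_norm.
  have [f lf [fp fx0]] := hahn_banach_real x0 sp; exists f => //; split.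
    move=> x; rewrite ler_norml fp andbT lerNl.
    have := fp (- x); have := lf (-1) x 0; rewrite (linear_fun0 lf) !addr0 !scaleN1r => ->.
    by move=> /le_trans; apply; rewrite -scaleN1r [leLHS]pZ normrN1 mul1r.
  by rewrite /= -fx0 ler_norm.
Qed.

End RealScalars.

(** * The complex numbers as scalars *)

Section ComplexScalars.
Context {R : realType}.
Local Open Scope complex_scope.

Lemma normc_le_ReIm (z : R[i]) : `|z| <= (`|complex.Re z| + `|complex.Im z|)%:C.
Proof.
rewrite {1}(complexE z) rmorphD/=; apply: le_trans (ler_normD _ _) _.
rewrite normrM.
have n (x : R) : `|x%:C| = `|x|%:C by rewrite normc_def/= expr0n addr0 sqrtr_sqr.
rewrite !n; have -> : `|'i%C : R[i]| = 1 by rewrite normc_def/= expr0n expr1n add0r sqrtr1.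
by rewrite mul1r.
Qed.

Lemma normc_ge_Im (z : R[i]) : `|complex.Im z|%:C <= `|z|.
Proof.
rewrite normc_def lecR -sqrtr_sqr ler_wsqrtr// lerDr; exact: sqr_ge0.
Qed.

Lemma complex_approx (z w : R[i]) (e : R) :
  `|complex.Re z - complex.Re w| <= e / 2 -> `|complex.Im z - complex.Im w| <= e / 2 -> `|z - w| <= e%:C.
Proof.
move=> h1 h2; apply: le_trans (normc_le_ReIm _) _; rewrite lecR.
have -> : complex.Re (z - w) = complex.Re z - complex.Re w by case: z w {h1 h2} => [? ?] [].
have -> : complex.Im (z - w) = complex.Im z - complex.Im w by case: z w {h1 h2} => [? ?] [].
by rewrite [leRHS]splitr lerD.
Qed.

(** A separate name for [V], so that it can carry its real vector space structure beside the complex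
    one. *)
Definition realified (V : lmodType R[i]) : Type := V.

Section Realified.
Context (V : lmodType R[i]).
HB.instance Definition _ := GRing.Zmodule.on (realified V).
Let rscale (r : R) (v : realified V) : realified V := r%:C *: (v : V).
Let rscaleA a b v : rscale a (rscale b v) = rscale (a * b) v.
Proof. by rewrite /rscale scalerA rmorphM. Qed.
Let rscale1 : left_id 1 rscale.
Proof. by move=> v; rewrite /rscale scale1r. Qed.
Let rscaleDr : right_distributive rscale +%R.
Proof. by move=> a u v; rewrite /rscale scalerDr. Qed.
Let rscaleDl v : {morph rscale^~ v : a b / a + b}.
Proof. by move=> a b; rewrite /rscale rmorphD scalerDl. Qed.
HB.instance Definition _ := GRing.Zmodule_isLmodule.Build R (realified V)
  rscaleA rscale1 rscaleDr rscaleDl.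

Lemma realified_scale (r : R) (v : realified V) : r *: v = r%:C *: (v : V) :> V.
Proof. by []. Qed.
End Realified.

(** The Bohnenblust-Sobczyk argument: a real functional [u] dominated by [p] is the real part of the
    complex linear map [x |-> u x - i u (i x)]. *)
Lemma hahn_banach_complex (V : lmodType R[i]) (p : V -> R) (x0 : V) :
  seminorm (real_complex R) p ->
  exists2 f : V -> R[i]^o, linear f &
    (forall x, `|f x| <= (p x)%:C) /\ (p x0)%:C <= `|f x0|.
Proof.
move=> [pD pZ].
have pZr (a : R[i]) x : `|a| = 1 -> p (a *: x) = p x.
  by move=> a1; apply: complexI; rewrite pZ a1 mul1r.
have n (x : R) : `|x%:C| = `|x|%:C by rewrite normc_def/= expr0n addr0 sqrtr_sqr.
have sp : sublinear (p : realified V -> R).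
  split=> // t x t0; apply: complexI; rewrite realified_scale pZ n ger0_norm//.
  by rewrite rmorphM.
have [u lu [up ux0]] := hahn_banach_real (x0 : realified V) sp.
pose f (x : V) : R[i] := u x +i* - u ('i%C *: x).
have uD (x y : V) : u (x + y) = u x + u y by have := lu 1 x y; rewrite !scale1r.
have uZ (r : R) (x : V) : u (r%:C *: x) = r * u x.
  by have := lu r x 0; rewrite !addr0 (linear_fun0 lu) addr0 realified_scale.
have lf : linear (f : V -> R[i]^o).
  move=> [a b] x y; rewrite /f scalerDr !uD.
  have -> : a +i* b = a%:C + b%:C * 'i%C by rewrite {1}(complexE (a +i* b)) /= ['i%C * _]mulrC.
  rewrite scalerA mulrDr mulrCA -expr2 sqr_i mulrN1 ['i%C * _]mulrC !scalerDl -!scalerA.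
  rewrite !uD -rmorphN !uZ.
  rewrite /GRing.scale/=.
  by apply/eqP; rewrite eq_complex /=; apply/andP; split; apply/eqP; ring.
exists f => //; split.
  move=> x; have [->|fx0] := eqVneq (f x) 0.
    rewrite normr0 lecR; have := sublinear_geN (x : realified V) sp.
    have -> : p (- x) = p x by rewrite -scaleN1r pZr// normrN1.
    by lra.
  (* Rotating [x] by this unimodular scalar makes [f (c *: x)] real, hence equal to [u (c *: x)],
     while [p] does not change. *)
  pose c := `|f x| / f x.
  have c1 : `|c| = 1 by rewrite normrM normr_id normfV divff// normr_eq0.
  have fc : f (c *: x) = `|f x|.
    have := lf c x 0; rewrite (linear_fun0 lf) !addr0 => ->.
    by rewrite /GRing.scale/= divfK.
  rewrite -fc -(pZr c x c1).
  have -> : f (c *: x) = (u (c *: x))%:C.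
    have : complex.Im (f (c *: x)) = 0 by rewrite fc; apply: ger0_Im.
    by rewrite /f /= => ->.
  by rewrite lecR.
have <- : complex.Re (f x0) = p x0 by rewrite /f/= ux0.
apply: le_trans (normc_ge_Re _); rewrite lecR ler_norm//.
Qed.

Lemma complex_scalar_field : scalar_field (real_complex R).
Proof.
split.
- by move=> x y; rewrite lecR.
- by move=> z z0; exists (complex.Re z); rewrite [RHS]RRe_real ?ger0_real.
- move=> T U u C UU uC.
  have [l1 h1] : exists l : R, forall e : R, 0 < e -> U [set t | `|complex.Re (u t) - l| <= e].
    apply: real_ultra => t.
    by rewrite -lecR; apply: le_trans (normc_ge_Re _) (uC t).
  have [l2 h2] : exists l : R, forall e : R, 0 < e -> U [set t | `|complex.Im (u t) - l| <= e].
    apply: real_ultra => t.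
    by rewrite -lecR; apply: le_trans (normc_ge_Im _) (uC t).
  exists (l1 +i* l2) => e e0; have e20 : 0 < e / 2 by rewrite divr_gt0.
  apply: filterS2 (h1 _ e20) (h2 _ e20) => t /= ht1 ht2.
  exact: complex_approx.
- exists (fun n => let q := odflt (0 : rat, 0 : rat) (unpickle n) in
                   ratr q.1 +i* ratr q.2) => z e e0.
  have e20 : 0 < e / 2 by rewrite divr_gt0.
  have [q1 h1] := rat_approx (complex.Re z) e20; have [q2 h2] := rat_approx (complex.Im z) e20.
  by exists (pickle (q1, q2)); rewrite pickleK; apply: complex_approx.
- exact: hahn_banach_complex.
Qed.

End ComplexScalars.

(** * Real-valued norms, seminorms and separation *)

Section RealNorm.
Context {R : realType} {K : numFieldType} (i : {rmorphism R -> K}).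
Context (sf : scalar_field i).

Let iE := emb_le sf.

Lemma emb_lt : {mono i : x y / x < y}.
Proof. exact: leW_mono iE. Qed.

Lemma emb_ge0 r : (0 <= i r) = (0 <= r).
Proof. by rewrite -(rmorph0 i) iE. Qed.

Lemma emb_gt0 r : (0 < i r) = (0 < r).
Proof. by rewrite -(rmorph0 i) emb_lt. Qed.

Lemma emb_inj : injective i.
Proof. exact: fmorph_inj. Qed.

Lemma norm_emb r : `|i r| = i `|r|.
Proof.
have [r0|/ltW r0] := leP 0 r; first by rewrite !ger0_norm ?emb_ge0.
by rewrite [`|r|]ler0_norm// -normrN -rmorphN ger0_norm// emb_ge0 oppr_ge0.
Qed.

(** The preimage under [i] of the [K]-valued norm, so that estimates take place in the ordered field
    [R], with its infima and linear arithmetic. *)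
Definition rnorm (V : normedZmodType K) (x : V) : R := xget 0 [set r | i r = `|x|].

Lemma rnormE (V : normedZmodType K) (x : V) : i (rnorm x) = `|x|.
Proof.
rewrite /rnorm; have [r xr] := emb_surj sf (normr_ge0 x).
by apply: (@xgetPex _ 0 [set r | i r = `|x|]); exists r.
Qed.

Lemma rnorm_le (V : normedZmodType K) (x : V) r : (rnorm x <= r) = (`|x| <= i r).
Proof. by rewrite -iE rnormE. Qed.

Lemma rnorm_ge (V : normedZmodType K) (x : V) r : (r <= rnorm x) = (i r <= `|x|).
Proof. by rewrite -iE rnormE. Qed.

Lemma rnorm_ge0 (V : normedZmodType K) (x : V) : 0 <= rnorm x.
Proof. by rewrite rnorm_ge rmorph0. Qed.

Lemma rnormD (V : normedZmodType K) (x y : V) : rnorm (x + y) <= rnorm x + rnorm y.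
Proof. by rewrite rnorm_le rmorphD !rnormE ler_normD. Qed.

Lemma rnormN (V : normedZmodType K) (x : V) : rnorm (- x) = rnorm x.
Proof. by apply: emb_inj; rewrite !rnormE normrN. Qed.

Lemma rnorm_eq0 (V : normedZmodType K) (x : V) : (rnorm x == 0) = (x == 0).
Proof. by rewrite -[RHS]normr_eq0 -rnormE fmorph_eq0. Qed.

Lemma rnorm0 (V : normedZmodType K) : rnorm (0 : V) = 0.
Proof. by apply/eqP; rewrite rnorm_eq0. Qed.

Lemma rnormM (a b : K) : rnorm (a * b) = rnorm a * rnorm b.
Proof. by apply: emb_inj; rewrite rmorphM !rnormE normrM. Qed.

Lemma rnorm1 : rnorm (1 : K) = 1.
Proof. by apply: emb_inj; rewrite rnormE normr1 rmorph1. Qed.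

Lemma rnorm_emb r : rnorm (i r) = `|r|.
Proof. by apply: emb_inj; rewrite rnormE norm_emb. Qed.

Lemma rnormZ (V : normedModType K) (a : K) (x : V) :
  rnorm (a *: x) = rnorm a * rnorm x.
Proof. by apply: emb_inj; rewrite rmorphM !rnormE normrZ. Qed.

Lemma seminormE (V : lmodType K) (p : V -> R) : seminorm i p <->
  (forall x y, p (x + y) <= p x + p y) /\
  (forall a x, p (a *: x) = rnorm a * p x).
Proof.
split=> -[pD pZ]; split=> // a x.
  by apply: emb_inj; rewrite pZ rmorphM rnormE.
by rewrite pZ rmorphM rnormE.
Qed.

Lemma seminorm_rnorm (V : normedModType K) (c : R) : 0 <= c ->
  seminorm i (fun x : V => c * rnorm x).
Proof.
move=> c0; apply/seminormE; split=> [x y|a x].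
  by rewrite -mulrDr ler_wpM2l// rnormD.
by rewrite rnormZ mulrCA.
Qed.

Lemma seminormI (V : lmodType K) (p : V -> R) :
  (forall x y, p (x + y) <= p x + p y) -> p 0 = 0 ->
  (forall a x, a != 0 -> p (a *: x) <= rnorm a * p x) -> seminorm i p.
Proof.
move=> pD p0 pZ; apply/seminormE; split=> // a x.
have [->|a0] := eqVneq a 0; first by rewrite scale0r rnorm0 mul0r.
apply/le_anti; rewrite pZ//=.
have ra0 : 0 < rnorm a by rewrite lt_neqAle eq_sym rnorm_eq0 a0 rnorm_ge0.
have := pZ a^-1 (a *: x); rewrite invr_eq0 scalerA mulVf// scale1r => /(_ a0).
rewrite -ler_pdivlMl//; congr (_ <= _ * _).
by apply: (mulfI (lt0r_neq0 ra0)); rewrite divff ?gt_eqF// -rnormM divff ?rnorm1.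
Qed.

(* The functional is dominated by the infimal convolution of [N] with the
   gauge whose epigraph is [G]. *)
Lemma separation (V : lmodType K) (N : V -> R) (G : V -> R -> Prop) (x0 : V) (m : R) :
  seminorm i N -> G 0 0 ->
  (forall u s v t, G u s -> G v t -> G (u + v) (s + t)) ->
  (forall a u t, G u t -> G (a *: u) (rnorm a * t)) ->
  (forall u t, G u t -> 0 <= t) ->
  (forall u t, G u t -> m <= N (x0 - u) + t) ->
  exists2 f : V -> K^o, linear f &
    [/\ forall x, `|f x| <= i (N x), forall u t, G u t -> `|f u| <= i t
      & i m <= `|f x0|].
Proof.
move=> /seminormE[ND NZ] G0 GD GZ Gpos Gm.
have N0 : N 0 = 0 by rewrite -(scale0r 0) NZ rnorm0 mul0r.
have Npos x : 0 <= N x.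
  have := ND x (-1 *: x); rewrite scaleN1r subrr N0 -scaleN1r NZ rnormN rnorm1 mul1r.
  by lra.
pose A x := [set r | exists u t, G u t /\ r = N (x - u) + t].
pose p x := inf (A x).
have A0 x : A x !=set0 by exists (N (x - 0) + 0), 0, 0.
have Apos x a : A x a -> 0 <= a.
  by move=> [u [t [Gut ->]]]; rewrite addr_ge0// (Gpos _ _ Gut).
have ple x u t : G u t -> p x <= N (x - u) + t.
  by move=> Gut; apply: inf_le_mem (Apos x) _; exists u, t.
have sp : seminorm i p.
  apply: seminormI.
  - move=> x y; apply: le_infD => // _ _ [u [s [Gus ->]]] [v [t [Gvt ->]]].
    apply: le_trans (ple _ _ _ (GD _ _ _ _ Gus Gvt)) _.
    by have := ND (x - u) (y - v); rewrite addrACA -opprD => h; lra.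
  - apply/le_anti/andP; split; first by rewrite (le_trans (ple _ _ _ G0))// subr0 N0 addr0.
    by apply: le_inf_lb => // a /Apos.
  - move=> a x a0.
    have ra0 : 0 < rnorm a by rewrite lt_neqAle eq_sym rnorm_eq0 a0 rnorm_ge0.
    rewrite -ler_pdivrMl//; apply: le_inf_lb => // _ [u [t [Gut ->]]].
    rewrite ler_pdivrMl//; apply: le_trans (ple _ _ _ (GZ a _ _ Gut)) _.
    by rewrite -scalerBr NZ mulrDr.
have [f lf [fp fx0]] := emb_hb sf x0 sp; exists f => //; split.
(* The three bounds come from the decompositions defining [p]: taking [u = 0] gives [p x <= N x],
   splitting off all of [u] gives [p u <= t], and [Gm] bounds every decomposition of [x0] below by
   [m]. *)
- move=> x; apply: le_trans (fp x) _; rewrite iE.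
  by apply: le_trans (ple x _ _ G0) _; rewrite subr0 addr0.
- move=> u t Gut; apply: le_trans (fp u) _; rewrite iE.
  by apply: le_trans (ple u _ _ Gut) _; rewrite subrr N0 add0r.
- apply: le_trans fx0; rewrite iE; apply: le_inf_lb => // _ [u [t [Gut ->]]].
  exact: Gm.
Qed.

End RealNorm.

(** * Bounded operators and the operator norm *)

Section BoundedOperators.
Context {R : realType} {K : numFieldType} (i : {rmorphism R -> K}).
Context (sf : scalar_field i).
Context (X Y : normedModType K).
Implicit Types (T : X -> Y) (x : X).

Lemma linear_continuous_bounded T : linear T -> continuous T ->
  exists2 C : R, 0 <= C & forall x, rnorm i (T x) <= C * rnorm i x.
Proof.
move=> lT cT; pose T' : {linear X -> Y} := HB.pack T (GRing.isLinear.Build K X Y *:%R T lT).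
have /linear_boundedP : bounded_near T' (nbhs 0) by apply/linear_bounded_continuous.
move=> /pinfty_ex_gt0[M M0 MT]; have [r Mr] := emb_surj sf (ltW M0).
exists r; first by rewrite -(emb_ge0 sf) -Mr ltW.
by move=> x; rewrite -(emb_le sf) rmorphM !(rnormE sf) -Mr; exact: MT.
Qed.

Lemma bounded_continuous T (C : R) : linear T ->
  (forall x, rnorm i (T x) <= C * rnorm i x) -> continuous T.
Proof.
move=> lT TC; pose T' : {linear X -> Y} := HB.pack T (GRing.isLinear.Build K X Y *:%R T lT).
suff : continuous T' by [].
apply/linear_bounded_continuous/linear_boundedP; near=> r => x.
have : `|T x| <= i C * `|x| by rewrite -!(rnormE sf) -rmorphM (emb_le sf).
move=> /le_trans; apply; apply: ler_wpM2r => //.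
near: r; apply: nbhs_pinfty_ge; rewrite realE.
by rewrite -(rmorph0 i) !(emb_le sf) le_total.
Unshelve. all: by end_near. Qed.

(** The supremum is formed in [R] and carried to [K] by [i], so [opnorm] does not fall back on a
    default value. Since 0 is one of the values, every upper bound in [K] is nonnegative and thus in
    the range of [i]. *)
Lemma opnorm_supremums T (C : R) : linear T ->
  (forall x, rnorm i (T x) <= C * rnorm i x) ->
  supremums [set `|T x| | x in [set x : X | `|x| <= 1]] (opnorm T).
Proof.
move=> lT TC; set A := [set _ | _ in _].
have T0 := linear_fun0 lT.
have A0 : A 0 by exists 0; rewrite /= ?normr0 ?T0 ?normr0 ?ler01.
pose B := [set r : R | A (i r)].
have hB : has_sup B.
  split; first by exists 0; rewrite /B/= rmorph0.
  exists `|C| => r [x /= x1 Txr]; rewrite -(emb_le sf) -Txr -(rnormE sf) (emb_le sf).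
  apply: le_trans (TC x) _; apply: le_trans (ler_norm _) _; rewrite normrM ler_piMr//.
  by rewrite ger0_norm ?(rnorm_ge0 sf)// (rnorm_le sf) rmorph1.
have sA : supremums A (i (sup B)).
  split.
    move=> _ [x x1 <-]; rewrite -(rnormE sf) (emb_le sf); apply: sup_upper_bound => //.
    by exists x => //; rewrite (rnormE sf).
  move=> w wA; have [r wr] := emb_surj sf (wA _ A0).
  rewrite wr (emb_le sf); apply: sup_le_ub; first exact: hB.1.
  by move=> s As; rewrite -(emb_le sf) -wr; exact: wA.
have nA : A != set0 by apply/set0P; exists 0.
rewrite /opnorm /supremum -/A (negPf nA).
by apply: xgetPex; exists (i (sup B)).
Qed.

Lemma opnorm_bound T x : linear T -> continuous T -> `|T x| <= opnorm T * `|x|.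
Proof.
move=> lT cT; have [C C0 TC] := linear_continuous_bounded lT cT.
have [ubT _] := opnorm_supremums lT TC.
have T0 := linear_fun0 lT.
have TZ a u : T (a *: u) = a *: T u by have := lT a u 0; rewrite T0 !addr0.
have [->|x0] := eqVneq x 0; first by rewrite T0 !normr0 mulr0.
have x0' : 0 < `|x| by rewrite normr_gt0.
rewrite -ler_pdivrMr// mulrC; apply: ubT; exists (`|x|^-1 *: x).
  by rewrite /= normrZ normfV normr_id mulVf// normr_eq0.
by rewrite TZ normrZ normfV normr_id.
Qed.

Lemma opnorm_emb T : linear T -> continuous T ->
  exists r, [/\ 0 <= r, opnorm T = i r & forall x, rnorm i (T x) <= r * rnorm i x].
Proof.
move=> lT cT; have [C C0 TC] := linear_continuous_bounded lT cT.
have T0 := linear_fun0 lT.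
have op0 : 0 <= opnorm T.
  have [ubT _] := opnorm_supremums lT TC; apply: ubT.
  by exists 0; rewrite /= ?normr0 ?T0 ?normr0 ?ler01.
have [r Tr] := emb_surj sf op0; exists r; split=> //.
  by rewrite -(emb_ge0 sf) -Tr.
by move=> x; rewrite -(emb_le sf) rmorphM !(rnormE sf) -Tr opnorm_bound.
Qed.

End BoundedOperators.

(** * Subsequences and finite linear combinations *)

Lemma subsequence_exists (P : nat -> nat -> Prop) :
  (forall k N, exists n, (N <= n)%N /\ P k n) ->
  exists s : nat -> nat, {homo s : m n / (m < n)%N} /\ forall k, P k (s k).
Proof.
move=> H; have /choice[g gP] : forall kN : nat * nat, exists n,
  (kN.2 <= n)%N /\ P kN.1 n by move=> [k N]; exact: H.
pose s := fix s k := if k is k'.+1 then g (k, (s k').+1) else g (0, 0)%N.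
exists s; split.
  by apply: homo_ltn; [exact: ltn_trans|move=> k; exact: (gP (k.+1, (s k).+1)).1].
by case=> [|k]; [exact: (gP (0, 0)%N).2|exact: (gP (k.+1, (s k).+1)).2].
Qed.

Lemma subsequence_ge (s : nat -> nat) n : {homo s : m n / (m < n)%N} -> (n <= s n)%N.
Proof. by move=> sm; elim: n => // n /leq_ltn_trans; apply; exact: sm. Qed.

Section FiniteCombinations.
Context {K : numFieldType} {V : lmodType K}.

(** Coefficients are a list, matched with [x 0], [x 1] and so on. Replacing them by indices into a
    dense sequence of scalars leaves lists of naturals, which are countable. *)
Fixpoint comb (x : nat -> V) (s : seq K) : V :=
  if s is c :: s' then c *: x 0%N + comb (x \o succn) s' else 0.

Lemma combD x s t : exists r, comb x s + comb x t = comb x r.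
Proof.
elim: s t x => [|c s IH] [|d t] x /=.
- by exists [::]; rewrite addr0.
- by exists (d :: t); rewrite add0r.
- by exists (c :: s); rewrite addr0.
- have [r e] := IH t (x \o succn); exists (c + d :: r).
  by rewrite /= -e scalerDl addrACA.
Qed.

Lemma combZ x a s : a *: comb x s = comb x (map ( *%R a) s).
Proof.
elim: s x => [|c s IH] x /=; first by rewrite scaler0.
by rewrite scalerDr IH scalerA.
Qed.

Lemma comb_nth x n : comb x (rcons (nseq n 0) 1) = x n.
Proof.
elim: n x => [|n IH] x /=; first by rewrite scale1r addr0.
by rewrite scale0r add0r IH.
Qed.

End FiniteCombinations.

(** * Weak sequential compactness of bounded sets in reflexive spaces *)

Section WeakCompactness.
Context {R : realType} {K : numFieldType} (i : {rmorphism R -> K}).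
Context (sf : scalar_field i) (X : normedModType K).
Local Notation rn := (rnorm i).

Lemma cvg_rnorm (V : normedModType K) (u : nat -> V) (l : V) :
  (u @ \oo --> l) <-> (forall e : R, 0 < e -> \forall n \near \oo, rn (u n - l) <= e).
Proof.
split=> [/cvgrPdist_le ul e e0|ul].
  have /ul : 0 < i e by rewrite (emb_gt0 sf).
  by apply: filterS => n; rewrite distrC -(rnorm_le sf).
apply/cvgrPdist_le => e e0; have [r er] := emb_surj sf (ltW e0).
have : 0 < r by rewrite -(emb_gt0 sf) -er.
by move=> /ul; apply: filterS => n; rewrite distrC (rnorm_le sf) -er.
Qed.

Lemma rnorm_small (V : normedModType K) (x : V) :
  (forall e : R, 0 < e -> rn x <= e) -> x = 0.
Proof.
move=> xe; apply/eqP; rewrite -(rnorm_eq0 sf); apply/eqP/le_anti.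
rewrite (rnorm_ge0 sf) andbT; apply/ler_addgt0Pr => e e0.
by rewrite add0r xe.
Qed.

Lemma dual_bound (f : X -> K^o) : dual f ->
  exists2 C, 0 <= C & forall x, rn (f x) <= C * rn x.
Proof. by move=> [lf cf]; exact: linear_continuous_bounded. Qed.

Lemma dualB (f : X -> K^o) x y : dual f -> f (x - y) = f x - f y.
Proof.
by move=> [lf _]; have := lf (-1) y x; rewrite !scaleN1r [- y + x]addrC => ->; rewrite addrC.
Qed.

Lemma dual_comb (a : K) (f g : X -> K^o) :
  dual f -> dual g -> dual (fun x => a *: f x + g x).
Proof.
move=> [lf cf] [lg cg]; split.
  by move=> c u v; rewrite lf lg !scalerDr !scalerA mulrC addrACA.
by move=> z; apply: cvgD; [apply: cvgZ; [exact: cvg_cst|exact: cf]|exact: cg].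
Qed.

Lemma norming_functional (y : X) : exists f : X -> K^o,
  [/\ dual f, forall x, rn (f x) <= rn x & rn y <= rn (f y)].
Proof.
have := seminorm_rnorm sf X ler01.
move=> /(emb_hb sf y)[f lf [fle fy]]; exists f.
have f1 x : rn (f x) <= rn x.
  by rewrite (rnorm_le sf); apply: le_trans (fle x) _; rewrite mul1r.
split=> //; last by rewrite (rnorm_ge sf) -[rn y]mul1r.
by split=> //; apply: (bounded_continuous (C := 1) sf) => // x; rewrite mul1r.
Qed.

(** The limits of [f (x t)] along [U] depend linearly on [f] and are bounded by a multiple of its
    norm. They form an element of the bidual, which reflexivity represents by a vector. *)
Lemma reflexive_ultra_limit (T : Type) (U : set_system T) (x : T -> X) (C : R) :
  reflexive_space X -> UltraFilter U -> (forall t, rn (x t) <= C) ->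
  exists a : X, forall f, dual f -> forall e, 0 < e ->
    U [set t | rn (f (x t) - f a) <= e].
Proof.
move=> refl UU xC.
pose lim_at (f : X -> K^o) (l : K^o) := forall e, 0 < e -> U [set t | rn (f (x t) - l) <= e].
have lim_ex f : dual f -> exists l, lim_at f l.
  move=> df; have [D D0 fD] := dual_bound df.
  have fx t : `|f (x t)| <= i (D * C).
    by rewrite -(rnorm_le sf); apply: le_trans (fD _) _; rewrite ler_wpM2l.
  have [l hl] := emb_ultra sf UU fx.
  by exists l => e /hl; apply: filterS => t; rewrite /= (rnorm_le sf).
have lim_uniq f l m : lim_at f l -> lim_at f m -> l = m.
  move=> hl hm; apply/eqP; rewrite -subr_eq0; apply/eqP/rnorm_small => e e0.
  have e20 : 0 < e / 2 by rewrite divr_gt0.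
  have [t [/= h1 h2]] := filter_ex (filterI (hl _ e20) (hm _ e20)).
  rewrite -[l - m](subrKA (f (x t))) [leRHS]splitr.
  by apply: le_trans (rnormD sf _ _) _; rewrite lerD// -(rnormN sf) opprB.
pose phi (f : X -> K^o) : K := xget 0 [set l : K^o | lim_at f l].
have phiP f : dual f -> lim_at f (phi f).
  by move=> /lim_ex[l fl]; apply: (@xgetPex _ _ [set l : K^o | lim_at f l]); exists l.
have [] := refl phi.
- move=> a f g df dg.
  have dfg := dual_comb a df dg.
  apply: (lim_uniq (fun x => a *: f x + g x)); first exact: phiP.
  move=> e e0.
  have e10 : 0 < e / 2 / (rn a + 1).
    by rewrite !divr_gt0// ltr_wpDl// (rnorm_ge0 sf).
  have e20 : 0 < e / 2 by rewrite divr_gt0.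
  apply: filterS2 (phiP f df _ e10) (phiP g dg _ e20) => t /= h1 h2.
  rewrite opprD addrACA -[a * phi f]/(a *: (phi f : K^o)) -scalerBr [leRHS]splitr.
  apply: le_trans (rnormD sf _ _) _; apply: lerD => //.
  rewrite (rnormZ sf); apply: le_trans (_ : (rn a + 1) * rn (f (x t) - phi f) <= _).
    by rewrite ler_wpM2r ?(rnorm_ge0 sf)// lerDl.
  by rewrite mulrC -ler_pdivlMr// ltr_wpDl// (rnorm_ge0 sf).
- exists (i `|C|) => f df; have [r [r0 -> fr]] := opnorm_emb sf df.1 df.2.
  rewrite -rmorphM -(rnorm_le sf); apply/ler_addgt0Pr => e e0.
  have [t /= h] := filter_ex (phiP f df e e0).
  rewrite -[phi f](subKr (f (x t))) addrC; apply: le_trans (rnormD sf _ _) _.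
  rewrite addrC (rnormN sf) lerD//; apply: le_trans (fr _) _.
  by rewrite mulrC ler_wpM2r// (le_trans (xC t))// ler_norm.
- by move=> a phia; exists a => f df; rewrite -phia//; exact: phiP.
Qed.

Lemma comb_dense (q : nat -> K) (x : nat -> X) (s : seq K) (e : R) :
  (forall z e, 0 < e -> exists n, `|z - q n| <= i e) -> 0 < e ->
  exists t : seq nat, rn (comb x s - comb x (map q t)) <= e.
Proof.
move=> qd; elim: s x e => [|c s IH] x e e0 /=.
  by exists [::]; rewrite subr0 (rnorm0 sf) ltW.
have e20 : 0 < e / 2 by rewrite divr_gt0.
have x1 : 0 < rn (x 0%N) + 1 by rewrite ltr_wpDl// (rnorm_ge0 sf).
have [n cn] := qd c _ (divr_gt0 e20 x1).
have [t st] := IH (x \o succn) _ e20; exists (n :: t) => /=.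
rewrite opprD addrACA -scalerBl [leRHS]splitr.
apply: le_trans (rnormD sf _ _) _; apply: lerD => //.
rewrite (rnormZ sf); move: cn; rewrite -(rnorm_le sf) ler_pdivlMr//; apply: le_trans.
by rewrite ler_wpM2l ?(rnorm_ge0 sf)// lerDl.
Qed.

Lemma weak_limit_annihilated (T : Type) (U : set_system T) (r : T -> nat)
    (x : nat -> X) (a : X) (f : X -> K^o) :
  ProperFilter U -> dual f ->
  (forall e, 0 < e -> U [set t | rn (f (x (r t)) - f a) <= e]) ->
  (forall n, f (x n) = 0) -> f a = 0.
Proof.
move=> UU df fa fx; apply: rnorm_small => e e0.
have [t /=] := filter_ex (fa e e0).
by rewrite fx sub0r (rnormN sf).
Qed.

(** If [z] stayed at distance more than [e] from the span, separation with the gauge that is 0 on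
    the span would give a functional vanishing on every [x n] but of modulus at least [e] at [z]. *)
Lemma closed_span_approx (x : nat -> X) (z : X) (e : R) : 0 < e ->
  (forall f : X -> K^o, dual f -> (forall n, f (x n) = 0) -> f z = 0) ->
  exists s, rn (z - comb x s) <= e.
Proof.
move=> e0 zx; apply: contrapT => /forallNP far.
pose G u t := t = 0 :> R /\ exists s, u = comb x s.
have := seminorm_rnorm sf X ler01.
move=> /(@separation _ _ _ sf _ _ G z e)[].
- by split=> //; exists [::].
- move=> u s v t [-> [su ->]] [-> [sv ->]]; split; first by rewrite addr0.
  by have [w ->] := combD x su sv; exists w.
- by move=> a u t [-> [su ->]]; rewrite mulr0; split=> //; exists (map ( *%R a) su); rewrite combZ.
- by move=> u t [->].
- move=> u t [-> [s ->]]; rewrite addr0 mul1r; apply/ltW; rewrite ltNge; apply/negP.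
  exact: far.
move=> f lf [fle fG fz].
have df : dual f.
  split=> //; apply: (bounded_continuous (C := 1) sf) => // y.
  by rewrite (rnorm_le sf).
have : f z = 0.
  apply: zx => // n; have /fG : G (x n) 0 by split=> //; exists (rcons (nseq n 0) 1); rewrite comb_nth.
  by rewrite rmorph0 normr_le0 => /eqP.
by move=> fz0; move: fz; rewrite fz0 normr0 -(rmorph0 i) (emb_le sf) leNgt e0.
Qed.

(* Since [U] is only an ultrafilter, its weak limit [a] is first tested against
   countably many functionals that norm the closed span of [x]; two weak cluster
   points of the resulting subsequence differ by a vector that these functionals
   annihilate. *)
Lemma reflexive_weak_subsequence (x : nat -> X) (C : R) :
  reflexive_space X -> (forall n, rn (x n) <= C) ->
  exists s : nat -> nat, {homo s : m n / (m < n)%N} /\ weakly_convergent (x \o s).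
Proof.
move=> refl xC; have [q qd] := emb_dense sf.
have [U [UU ooU]] := @ultraFilterLemma nat \oo _.
have [a aP] := reflexive_ultra_limit refl UU xC.
pose D (j : nat) := comb x (map q (odflt [::] (unpickle j))).
have /choice[F FP] := fun j => norming_functional (D j).
have [s [sm sP]] : exists s : nat -> nat, {homo s : m n / (m < n)%N} /\
    forall k, forall j, (j <= k)%N -> rn (F j (x (s k)) - F j a) <= k.+1%:R^-1.
  apply: (@subsequence_exists (fun k n => forall j, (j <= k)%N ->
    rn (F j (x n) - F j a) <= k.+1%:R^-1)) => k N.
  (* Finitely many conditions hold together on a set of [U]; as [U] also contains all tails, the
     index can be taken beyond [N]. *)
  have Uk m : U [set n | forall j, (j < m)%N -> rn (F j (x n) - F j a) <= k.+1%:R^-1].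
    elim: m => [|m IH]; first by apply: filterS filterT.
    have k0 : 0 < k.+1%:R^-1 :> R by rewrite invr_gt0 ltr0n.
    have [dF _ _] := FP m.
    apply: filterS2 IH (aP _ dF _ k0) => n h1 h2 j; rewrite ltnS leq_eqVlt.
    by move=> /predU1P[->|/h1].
  have UN : U [set n | (N <= n)%N] by apply: ooU; exact: nbhs_infty_ge.
  have [n [h1 h2]] := filter_ex (filterI UN (Uk k.+1)).
  by exists n; split.
exists s; split=> //; exists a => f df; apply/cvg_rnorm => e e0.
apply: contrapT => nfe.
have [r [rm rP]] : exists r : nat -> nat, {homo r : m n / (m < n)%N} /\
    forall k, ~ rn (f (x (s (r k))) - f a) <= e.
  apply: (@subsequence_exists (fun _ n => ~ rn (f (x (s n)) - f a) <= e)) => _ N; apply: contrapT => /forallNP h.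
  apply: nfe; exists N => // n /= Nn; apply: contrapT => fn.
  by apply: (h n).
(* A second ultrafilter gives a weak cluster point [b] of the subsequence on which [f] stays away
   from [f a]. Showing [b = a] is a contradiction. *)
have [W [WU ooW]] := @ultraFilterLemma nat \oo _.
have [b bP] := reflexive_ultra_limit refl WU (fun n => xC (s (r n))).
have FE j : F j (b - a) = 0.
  have [dF _ _] := FP j; rewrite dualB//; apply: rnorm_small => d d0.
  have d20 : 0 < d / 2 by rewrite divr_gt0.
  have Wa : W [set n | rn (F j (x (s (r n))) - F j a) <= d / 2].
    apply: ooW; near=> n => /=.
    have jn : (j <= n)%N by near: n; exact: nbhs_infty_ge.
    have nr := subsequence_ge n rm.
    apply: le_trans (sP (r n) j (leq_trans jn nr)) _.
    apply: le_trans (_ : n.+1%:R^-1 <= _).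
      by rewrite lef_pV2 ?posrE ?ltr0n// ler_nat ltnS.
    near: n; have /cvgrPdist_le/(_ _ d20) := @cvg_harmonic R.
    by apply: filterS => n; rewrite sub0r normrN ger0_norm ?harmonic_ge0.
  have [n [/= h1 h2]] := filter_ex (filterI Wa (bP _ dF _ d20)).
  rewrite -(subrKA (F j (x (s (r n))))) [leRHS]splitr.
  by apply: le_trans (rnormD sf _ _) _; rewrite lerD// -(rnormN sf) opprB.
(* Functionals vanishing on all [x n] vanish at [a] and [b], so [b - a] is in the closed span and
   some [D j] is within [d / 2] of it. As [F j] norms [D j] and kills [b - a], the norm of [D j] is
   at most that of [F j (b - a - D j)], hence at most [d / 2]. *)
have ba : b - a = 0.
  apply: rnorm_small => d d0; have d40 : 0 < d / 4 by rewrite divr_gt0.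
  have [|w hw] := @closed_span_approx x (b - a) _ d40.
    move=> g dg gx; rewrite dualB//.
    have -> : g b = 0.
      exact: (weak_limit_annihilated (r := s \o r) (@ultra_proper _ _ WU) dg (bP g dg) gx).
    have -> : g a = 0.
      exact: (weak_limit_annihilated (r := id) (@ultra_proper _ _ UU) dg (aP g dg) gx).
    exact: subr0.
  have [t ht] := comb_dense x w qd d40.
  pose j := pickle t; have [dF F1 FD] := FP j.
  have Dj : rn (b - a - D j) <= d / 2.
    rewrite /D /j pickleK /= -(subrKA (comb x w)).
    by apply: le_trans (rnormD sf _ _) _; lra.
  have DD : rn (D j) <= d / 2.
    apply: le_trans FD _; rewrite -(rnormN sf) -sub0r -(FE j) -dualB//.
    exact: le_trans (F1 _) Dj.
  rewrite -(subrK (D j) (b - a)); apply: le_trans (rnormD sf _ _) _.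
  by rewrite [leRHS]splitr lerD.
have [n /= fn] := filter_ex (bP f df e e0).
apply: (rP n); suff <- : b = a by [].
by apply/eqP; rewrite -subr_eq0 ba.
Unshelve. all: by end_near. Qed.

End WeakCompactness.

(** * Finite dimension, and reflexivity of super-reflexive spaces *)

Section FiniteDimensional.
Context {R : realType} {K : numFieldType} (i : {rmorphism R -> K}).
Context (sf : scalar_field i).

(* Induction on [bs]: if [h] in [D] vanishes on the tail but [phi h != 0], then
   [phi] minus a multiple of the evaluation at [b] satisfies the hypothesis for
   the tail. *)
Lemma functional_is_evaluation (V : lmodType K) (D : set (V -> K^o))
    (phi : (V -> K^o) -> K) (bs : seq V) :
  (forall f, D f -> linear f) ->
  (forall a f g, D f -> D g -> D (fun x => a *: f x + g x)) ->
  (forall a f g, D f -> D g -> phi (fun x => a *: f x + g x) = a * phi f + phi g) ->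
  (forall f, D f -> (forall b, b \in bs -> f b = 0) -> phi f = 0) ->
  exists x, forall f, D f -> phi f = f x.
Proof.
move=> Dlin Dcl; elim: bs phi => [|b bs IH] phi phiD phi0.
  exists 0 => f Df; rewrite phi0//.
  by rewrite (linear_fun0 (Dlin _ Df)).
have [[h [Dh hbs ph]]|noh] := pselect (exists h, [/\ D h,
    forall c, c \in bs -> h c = 0 & phi h != 0]); last first.
  apply: IH => // f Df fbs; apply/eqP; apply: contrapT => /negP pf.
  by apply: noh; exists f.
have hb : h b != 0.
  apply: contraNneq ph => hb; apply/eqP/phi0 => // c.
  by rewrite inE => /predU1P[->|/hbs].
pose r : K := phi h / h b.
have [||x xP] := IH (fun f => phi f - r * f b).
- by move=> a f g Df Dg; rewrite phiD// /GRing.scale/=; ring.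
- move=> f Df fbs.
  have : phi (fun x => - (f b / h b) *: h x + f x) = 0.
    apply: phi0; first exact: Dcl.
    move=> c; rewrite inE => /predU1P[->|cbs]; last by rewrite /= (hbs c cbs) (fbs c cbs) scaler0 addr0.
    by rewrite /GRing.scale/= mulNr divfK// addNr.
  rewrite phiD// => e; rewrite -[RHS]e /r; ring.
exists (r *: b + x) => f Df; rewrite (Dlin _ Df) -xP//.
by rewrite /GRing.scale/= addrC subrK.
Qed.

(** A functional vanishing on a finite spanning family is zero, and [phi] is zero there, so [phi] is
    an evaluation. *)
Lemma finite_dimensional_reflexive (V : normedModType K) :
  finite_dimensional [set: V] -> reflexive_space V.
Proof.
move=> [n [b Vb]] phi phiD _.
apply: (@functional_is_evaluation V (@dual K V) phi (codom b)) => //.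
- by move=> f [].
- exact: dual_comb.
- move=> f df fb.
  have f0 x : f x = 0.
    have : [set: V] x by [].
    rewrite Vb => -[a _ <-]; pose f' : {linear V -> K^o} :=
      HB.pack f (GRing.isLinear.Build K V K^o *:%R f df.1).
    rewrite -[f]/(f' : V -> K^o) linear_sum big1// => j _.
    by rewrite linearZ /= fb ?scaler0// codom_f.
  have := phiD (-1) f f df df; rewrite mulN1r addNr => <-; congr phi.
  by apply/funext => x; rewrite f0 scaler0 addr0.
Qed.

(** The identity represents [V] finitely in itself. Super-reflexivity speaks only of infinite
    dimensional spaces, so the finite dimensional case is treated apart. *)
Lemma super_reflexive_reflexive (V : completeNormedModType K) :
  super_reflexive V -> reflexive_space V.
Proof.
move=> sV; have [/finite_dimensional_reflexive//|infV] := pselect (finite_dimensional [set: V]).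
apply: sV => // F _ l l1; exists id; split=> // u _.
have l0 : 0 < l by rewrite (lt_trans ltr01).
by rewrite ler_pdivrMl// !ler_peMl// ltW.
Qed.

End FiniteDimensional.

(** * Minimal vectors and their functionals *)

Section MinimalVectors.
Context {R : realType} {K : numFieldType} (i : {rmorphism R -> K}).
Context (sf : scalar_field i) (X : normedModType K).
Local Notation rn := (rnorm i).

Lemma closed_rnorm (M : set X) :
  (forall z, (forall d : R, 0 < d -> exists w, M w /\ rn (z - w) <= d) -> M z) ->
  closed M.
Proof.
move=> MP z clz; apply: MP => d d0.
have id0 : 0 < i d by rewrite (emb_gt0 sf).
have [w [Mw zw]] := clz _ (nbhsx_ballx z _ id0).
by exists w; split=> //; rewrite (rnorm_le sf); apply/ltW; move: zw; rewrite -ball_normE.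
Qed.

Lemma iter_linear (Q : {linear X -> X}) n : linear (iter n Q).
Proof.
by elim: n => [|n IH] a u v //=; rewrite IH linearP.
Qed.

Lemma iter_bounded (Q : X -> X) (C : R) n : 0 <= C ->
  (forall x, rn (Q x) <= C * rn x) -> forall x, rn (iter n Q x) <= C ^+ n * rn x.
Proof.
move=> C0 QC x; elim: n => [|n IH] /=; first by rewrite expr0 mul1r.
by apply: le_trans (QC _) _; rewrite exprS -mulrA ler_wpM2l.
Qed.

Lemma iter_dense_range (Q : {linear X -> X}) (C : R) n : 0 <= C ->
  (forall x, rn (Q x) <= C * rn x) ->
  (forall z d, 0 < d -> exists y, rn (z - Q y) <= d) ->
  forall z d, 0 < d -> exists y, rn (z - iter n Q y) <= d.
Proof.
move=> C0 QC dQ; elim: n => [|n IH] z d d0.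
  by exists z; rewrite subrr (rnorm0 sf) ltW.
have d20 : 0 < d / 2 by rewrite divr_gt0.
have C1 : 0 < C + 1 by rewrite ltr_wpDl.
have [y' zy'] := dQ z _ d20; have [y yy] := IH y' _ (divr_gt0 d20 C1).
exists y; rewrite /= -(subrKA (Q y')) [leRHS]splitr.
apply: le_trans (rnormD sf _ _) _; apply: lerD => //.
rewrite -linearB; apply: le_trans (QC _) _; apply: le_trans (_ : (C + 1) * (d / 2 / (C + 1)) <= _).
  by apply: ler_pM => //; [exact: rnorm_ge0|rewrite lerDl].
by rewrite mulrC divfK// gt_eqF.
Qed.

(** Intermediate value theorem for the distance from [x0] to [i t *: z]: at least [e] at [t = 0], at
    most [e] at [t = 1]. *)
Lemma segment_meets_sphere (x0 z : X) (e : R) :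
  rn (x0 - z) <= e -> e <= rn x0 ->
  exists2 t : R, 0 <= t <= 1 & rn (x0 - i t *: z) = e.
Proof.
move=> ze ex0; pose f (t : R) := rn (x0 - i t *: z).
have flip s t : f s <= f t + `|t - s| * rn z.
  rewrite -(rnorm_emb sf (t - s)) -(rnormZ sf) rmorphB scalerBl /f.
  by apply: le_trans (rnormD sf _ _); rewrite addrA subrK.
have cf : continuous f.
  move=> t; apply/cvgrPdist_le => d d0; near=> s.
  have : `|t - s| * (rn z + 1) <= d.
    rewrite -ler_pdivlMr ?ltr_wpDl ?(rnorm_ge0 sf)//; near: s.
    by apply: cvgr_dist_le => //; rewrite divr_gt0// ltr_wpDl// (rnorm_ge0 sf).
  rewrite mulrDr mulr1 => h; have := flip s t; have := flip t s.
  rewrite [`|s - t|]distrC ler_norml; have := normr_ge0 (t - s); lra.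
have f0 : f 0 = rn x0 by rewrite /f rmorph0 scale0r subr0.
have f1 : f 1 = rn (x0 - z) by rewrite /f rmorph1 scale1r.
have [|t] := @IVT R f 0 1 e ler01 (continuous_subspaceT cf).
  by rewrite f0 f1 ge_min le_max ze ex0 orbT.
by rewrite in_itv/= => t01 ft; exists t.
Unshelve. all: by end_near. Qed.

Lemma minimal_vector (P : X -> X) (x0 : X) (e : R) :
  linear P -> continuous P -> 0 < e < 1 -> rn x0 = 1 ->
  (forall z d, 0 < d -> exists y, rn (z - P y) <= d) ->
  exists (y : X) (g : X -> K^o),
    [/\ 0 < rn y, rn (x0 - P y) = e, linear g,
        forall x, rn (g x) <= e^-1 * rn x &
        1 <= rn (g x0) /\ forall z, rn (g (P z)) <= 2 * rn z / rn y].
Proof.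
move=> lP cP /andP[e0 e1] x01 dP.
have [C C0 PC] := linear_continuous_bounded sf lP cP.
have C1 : 0 < C + 1 by rewrite ltr_wpDl.
have P0 := linear_fun0 lP.
have PZ a u : P (a *: u) = a *: P u by have := lP a u 0; rewrite P0 !addr0.
pose A := [set r | exists y, rn (x0 - P y) <= e /\ r = rn y].
have A0 : A !=set0 by have [y hy] := dP x0 e e0; exists (rn y), y.
have Alb a : A a -> (1 - e) / (C + 1) <= a.
  move=> [y [hy ->]]; rewrite ler_pdivrMr// mulrDr mulr1.
  (* Vectors mapped into the [e]-ball around the unit vector [x0] cannot be short, since [P y] has
     norm at least [1 - e]; this makes the infimum [d] positive. *)
  have : 1 <= rn (x0 - P y) + rn (P y).
    by rewrite -x01 -{1}(subrK (P y) x0) rnormD.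
  by have := PC y; have := rnorm_ge0 sf y; rewrite mulrC; lra.
pose d := inf A.
have d0 : 0 < d.
  by apply: lt_le_trans (le_inf_lb A0 Alb); rewrite divr_gt0// subr_gt0.
have dA y : rn (x0 - P y) <= e -> d <= rn y.
  by move=> hy; apply: inf_le_mem Alb _; exists y.
have [y1 [hy1 y1d]] : exists y1, rn (x0 - P y1) <= e /\ rn y1 <= 2 * d.
  apply: contrapT => /forallNP h.
  have : 2 * d <= d.
    apply: le_inf_lb => // _ [y [hy ->]]; apply/ltW; rewrite ltNge; apply/negP => yd.
    exact: (h y).
  by lra.
(* Shrinking [y1] puts its image exactly on the sphere and keeps its norm below [2 * d]. *)
have [|t /andP[t0 t1] ht] := segment_meets_sphere hy1 _; first by rewrite x01 ltW.
have yd : rn (i t *: y1) <= 2 * d.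
  rewrite (rnormZ sf) (rnorm_emb sf) ger0_norm//.
  by apply: le_trans y1d; rewrite ler_piMl// (rnorm_ge0 sf).
have y0 : 0 < rn (i t *: y1).
  rewrite lt_neqAle eq_sym (rnorm_eq0 sf) (rnorm_ge0 sf) andbT.
  apply/eqP => ty; move: ht; rewrite -PZ ty P0 subr0 x01 => h.
  by rewrite h ltxx in e1.
(* [G u s] places [u] in [s] times the image under [P] of the ball of radius [d]. Separation applies
   with level 1: if [P y] is in the [e]-ball, minimality of [d] gives [1 <= s]; otherwise the term
   [e^-1 * rn (x0 - P y)] exceeds 1. *)
pose G u s := exists y, u = P y /\ rn y <= s * d.
have ei0 : 0 <= e^-1 by rewrite invr_ge0 ltW.
have [|||||g lg [gN gG gx0]] := @separation _ _ _ sf _ _ G x0 1 (seminorm_rnorm sf X ei0).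
- by exists 0; rewrite P0 (rnorm0 sf) mul0r.
- move=> _ r _ s [u [-> ur]] [v [-> vs]]; exists (u + v); split.
    by have := lP 1 u v; rewrite !scale1r.
  by rewrite mulrDl; apply: le_trans (rnormD sf _ _) _; rewrite lerD.
- move=> a _ s [u [-> us]]; exists (a *: u); split; first by rewrite PZ.
  by rewrite (rnormZ sf) -mulrA ler_wpM2l// (rnorm_ge0 sf).
- move=> _ s [u [_ us]]; rewrite -(pmulr_lge0 _ d0).
  exact: le_trans (rnorm_ge0 sf u) us.
- move=> _ s [u [-> us]]; have s0 : 0 <= s.
    by rewrite -(pmulr_lge0 _ d0); exact: le_trans (rnorm_ge0 sf u) us.
  have [xu|xu] := leP (rn (x0 - P u)) e.
    have : d <= s * d by apply: le_trans (dA _ xu) us.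
    rewrite -{1}[d]mul1r ler_pM2r// => s1; apply: le_trans s1 _.
    by rewrite lerDr mulr_ge0// (rnorm_ge0 sf).
  apply: le_trans (_ : e^-1 * rn (x0 - P u) <= _); last by rewrite lerDl.
  by rewrite mulrC ler_pdivlMr// mul1r ltW.
exists (i t *: y1), g; split=> //.
- by rewrite PZ.
- by move=> x; rewrite (rnorm_le sf).
split; first by rewrite (rnorm_ge sf).
(* The factor 2 of the conclusion enters when [d] is replaced by the norm of the chosen vector,
   which is at most [2 * d]. *)
move=> z; have : rn (g (P z)) <= rn z / d.
  by rewrite (rnorm_le sf); apply: gG; exists z; rewrite divfK// gt_eqF.
move=> /le_trans; apply; rewrite ler_pdivrMr// mulrAC ler_pdivlMr//.
by rewrite [2 * _]mulrC -mulrA ler_wpM2l ?(rnorm_ge0 sf).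
Qed.

End MinimalVectors.

(** * Quasi-nilpotence and two constructions of hyperinvariant subspaces *)

Section HyperinvariantSubspace.
Context {R : realType} {K : numFieldType} (i : {rmorphism R -> K}).
Context (sf : scalar_field i) (X : normedModType K) (Q : {linear X -> X}).
Context (cQ : continuous Q).
Local Notation rn := (rnorm i).

Lemma linear_coercion (T : {linear X -> X}) : linear T.
Proof. exact: linearP. Qed.

Lemma iter_continuous n : continuous (iter n Q).
Proof.
have [C C0 QC] := linear_continuous_bounded sf (linear_coercion Q) cQ.
exact: bounded_continuous (iter_linear Q n) (fun x => iter_bounded n C0 QC x).
Qed.

Lemma nthrootP n (s : R) : (0 < n)%N -> 0 <= s ->
  0 <= Defs.nthroot n (i s) /\ Defs.nthroot n (i s) ^+ n = i s.
Proof.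
move=> n0 s0; apply: (@xgetPex _ 0 [set r : K | 0 <= r /\ r ^+ n = i s]).
exists (i (s `^ n%:R^-1)); split; first by rewrite (emb_ge0 sf) powR_ge0.
by rewrite -rmorphXn -powR_mulrn ?powR_ge0// -powRrM mulVf ?pnatr_eq0 -?lt0n// powRr1.
Qed.

Lemma quasi_nilpotent_iter (d : R) : quasi_nilpotent Q -> 0 < d ->
  \forall n \near \oo, forall x, rn (iter n Q x) <= d ^+ n * rn x.
Proof.
move=> qQ d0; have id0 : 0 < i d by rewrite (emb_gt0 sf).
move/cvgrPdist_le : qQ => /(_ _ id0) qQ.
near=> n => x.
have n0 : (0 < n)%N by near: n; exact: nbhs_infty_gt.
have [r [r0 nr Qr]] := opnorm_emb sf (iter_linear Q n) (@iter_continuous n).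
have [t0 tn] := nthrootP n0 r0.
have td : Defs.nthroot n (i r) <= i d.
  rewrite -nr -[leLHS]ger0_norm ?nr// -normrN -sub0r -nr.
  by near: n.
apply: le_trans (Qr x) _; rewrite ler_wpM2r ?(rnorm_ge0 sf)//.
by rewrite -(emb_le sf) rmorphXn -tn lerXn2r// nnegrE ltW.
Unshelve. all: by end_near. Qed.

(** With [d = 1 / (k + 1)], failure from [N] on gives [d ^+ j * rn (y (N + j)) <= rn (y N)].
    Eventually the [n]-th power of [Q] is bounded by [(d / 2) ^+ n], so [c * 2 ^+ n] would stay
    bounded. *)
Lemma small_ratio (y : nat -> X) (c : R) : quasi_nilpotent Q -> 0 < c ->
  (forall n, c <= rn (iter n Q (y n))) ->
  forall k N, exists n, (N <= n)%N /\ rn (y n) <= k.+1%:R^-1 * rn (y n.+1).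
Proof.
move=> qQ c0 yc k N; apply: contrapT => /forallNP h.
pose d : R := k.+1%:R^-1.
have d0 : 0 < d by rewrite invr_gt0 ltr0n.
have yd j : d ^+ j * rn (y (N + j)%N) <= rn (y N).
  elim: j => [|j IH]; first by rewrite expr0 mul1r addn0.
  apply: le_trans IH; rewrite exprSr -mulrA ler_wpM2l ?exprn_ge0 ?ltW//.
  rewrite addnS ltNge; apply/negP => hj; apply: (h (N + j)%N); split=> //.
  exact: leq_addr.
have d20 : 0 < d / 2 by rewrite divr_gt0.
have [M _ MP] := quasi_nilpotent_iter qQ d20.
pose B := d ^+ N * rn (y N).
have cB j : (M <= N + j)%N -> c * 2 ^+ (N + j) <= B.
  move=> Mj; have := MP _ Mj (y (N + j)%N) => /(le_trans (yc _)).
  rewrite exprMn [2^-1 ^+ _]exprVn mulrAC ler_pdivlMr ?exprn_gt0// => /le_trans; apply.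
  by rewrite exprD -mulrA; apply: ler_wpM2l; [exact: exprn_ge0 (ltW d0)|exact: yd].
have [j jB] : exists j : nat, B / c < j%:R.
  by exists (Num.truncn (B / c)).+1; exact: truncnS_gt.
have := cB (maxn M j) (leq_trans (leq_maxl _ _) (leq_addl _ _)).
apply/negP; rewrite -ltNge mulrC -ltr_pdivrMr//; apply: lt_trans jB _.
rewrite -natrX ltr_nat; apply: leq_ltn_trans (leq_maxr M j) _.
by apply: leq_ltn_trans (leq_addl N _) (ltn_expl _ _).
Qed.


(** The subspace is the closure of the range of [Q], which the commutant preserves because
    [T (Q y) = Q (T y)]. *)
Lemma closure_range_hyperinvariant : (exists x, Q x <> 0) ->
  ~ (forall z d, 0 < d -> exists y, rn (z - Q y) <= d) ->
  has_nontrivial_hyperinvariant_subspace Q.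
Proof.
move=> [x Qx] ndQ.
exists [set z | forall d, 0 < d -> exists y, rn (z - Q y) <= d]; split.
- split.
  + apply: (closed_rnorm sf) => z zM d d0; have d20 : 0 < d / 2 by rewrite divr_gt0.
    have [w [/(_ _ d20)[y wy] zw]] := zM _ d20; exists y.
    by rewrite -(subrKA w) [leRHS]splitr; apply: le_trans (rnormD sf _ _) _; exact: lerD.
  + by move=> d d0; exists 0; rewrite linear0 subrr (rnorm0 sf) ltW.
  + move=> a u v uM vM d d0; have d20 : 0 < d / 2 by rewrite divr_gt0.
    have a1 : 0 < rn a + 1 by rewrite ltr_wpDl// (rnorm_ge0 sf).
    have [y uy] := uM _ (divr_gt0 d20 a1); have [z vz] := vM _ d20.
    exists (a *: y + z); rewrite linearP opprD addrACA -scalerBr [leRHS]splitr.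
    apply: le_trans (rnormD sf _ _) _; apply: lerD => //; rewrite (rnormZ sf).
    move: uy; rewrite ler_pdivlMr// mulrC; apply: le_trans.
    by rewrite ler_wpM2r ?(rnorm_ge0 sf)// lerDl.
- move=> T [cT TQ] z zM d d0.
  have [C C0 TC] := linear_continuous_bounded sf (linear_coercion T) cT.
  have C1 : 0 < C + 1 by rewrite ltr_wpDl.
  have [y zy] := zM _ (divr_gt0 d0 C1); exists (T y); rewrite -TQ -linearB.
  apply: le_trans (TC _) _; move: zy; rewrite ler_pdivlMr// mulrC; apply: le_trans.
  by rewrite ler_wpM2r ?(rnorm_ge0 sf)// lerDl.
- move=> M0; apply: Qx.
  suff : [set z | forall d, 0 < d -> exists y, rn (z - Q y) <= d] (Q x) by rewrite M0.
  by move=> d d0; exists x; rewrite subrr (rnorm0 sf) ltW.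
- move=> MT; apply: ndQ => z d d0.
  have : [set: X] z by [].
  by rewrite -MT => /(_ d d0).
Qed.

(* The subspace consists of the vectors whose images under the commutant are
   asymptotically annihilated by [g k \o Q]. *)
Lemma asymptotic_kernel_hyperinvariant (g : nat -> X -> K^o) (C : R) (x0 w : X) :
  (forall k, linear (g k)) -> 0 <= C -> (forall k x, rn (g k x) <= C * rn x) ->
  (forall k, 1 <= rn (g k x0)) ->
  (forall z d, 0 < d -> exists y, rn (z - Q y) <= d) ->
  w <> 0 ->
  (forall T, commutant Q T -> forall d, 0 < d ->
     \forall k \near \oo, rn (g k (Q (T w))) <= d) ->
  has_nontrivial_hyperinvariant_subspace Q.
Proof.
move=> lg C0 gC gx0 dQ w0 gw.
have g0 k := linear_fun0 (lg k).
have gB k u v : g k (u - v) = g k u - g k v.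
  by have := lg k (-1) v u; rewrite !scaleN1r [- v + u]addrC => ->; rewrite addrC.
have C1 : 0 < C + 1 by rewrite ltr_wpDl.
pose M := [set v | forall T, commutant Q T -> forall d, 0 < d ->
     \forall k \near \oo, rn (g k (Q (T v))) <= d].
exists M; split.
- split.
  (* The common bound [C] on all [g k] makes the error of replacing [z] by a nearby [v] uniform in
     [k]. *)
  + apply: (closed_rnorm sf) => z zM T cT d d0.
    have [D D0 TD] := linear_continuous_bounded sf (linear_coercion T) cT.1.
    have [E E0 QE] := linear_continuous_bounded sf (linear_coercion Q) cQ.
    have d20 : 0 < d / 2 by rewrite divr_gt0.
    have B0 : 0 <= C * (E * D) by rewrite !mulr_ge0.
    have B1 : 0 < C * (E * D) + 1 by rewrite ltr_wpDl.
    have [v [vM zv]] := zM _ (divr_gt0 d20 B1).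
    apply: filterS (vM T cT _ d20) => k gv.
    have -> : g k (Q (T z)) = g k (Q (T (z - v))) + g k (Q (T v)).
      by rewrite !linearB gB subrK.
    rewrite [leRHS]splitr; apply: le_trans (rnormD sf _ _) _; apply: lerD => //.
    apply: le_trans (gC _ _) _.
    apply: le_trans (_ : C * (E * (D * rn (z - v))) <= _).
      by rewrite ler_wpM2l//; apply: le_trans (QE _) _; rewrite ler_wpM2l.
    move: zv; rewrite ler_pdivlMr//; apply: le_trans.
    by rewrite !mulrA [leLHS]mulrC ler_wpM2l ?(rnorm_ge0 sf)// lerDl.
  + by move=> T cT d d0; apply: nearW => k; rewrite !linear0 g0 (rnorm0 sf) ltW.
  + move=> a u v uM vM T cT d d0; have d20 : 0 < d / 2 by rewrite divr_gt0.
    have a1 : 0 < rn a + 1 by rewrite ltr_wpDl// (rnorm_ge0 sf).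
    apply: filterS2 (uM T cT _ (divr_gt0 d20 a1)) (vM T cT _ d20) => k gu gv.
    rewrite !linearP lg [leRHS]splitr; apply: le_trans (rnormD sf _ _) _.
    apply: lerD => //; rewrite (rnormZ sf).
    move: gu; rewrite ler_pdivlMr// mulrC; apply: le_trans.
    by rewrite ler_wpM2r ?(rnorm_ge0 sf)// lerDl.
- move=> S [cS SQ] v vM T [cT TQ] d d0; apply: (vM (T \o S)) => //; split.
    by move=> z; apply: continuous_comp; [exact: cS|exact: cT].
  by move=> z /=; rewrite SQ TQ.
- by move=> M0; apply: w0; have : M w by []; rewrite M0.
(* Were [M] the whole space, a [v] with [Q v] close to [x0], tested with the identity of the
   commutant, would give modulus at most [1/2 + 1/4] for some [g N x0], against the lower bound
   1. *)
- move=> MT; have d0 : 0 < 2^-1 :> R by rewrite invr_gt0.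
  have [v xv] := dQ x0 _ (divr_gt0 d0 C1).
  have : M v by rewrite MT.
  have cid : commutant Q (idfun : {linear X -> X}) by split=> // z; exact: cvg_id.
  have d40 : 0 < 4^-1 :> R by rewrite invr_gt0.
  move=> /(_ _ cid _ d40) [N _ /(_ N (leqnn N))] /= gv.
  have : rn (g N x0) <= rn (g N (x0 - Q v)) + rn (g N (Q v)).
    by rewrite -{1}(subrK (g N (Q v)) (g N x0)) -gB; exact: rnormD.
  have : rn (g N (x0 - Q v)) <= 2^-1.
    apply: le_trans (gC _ _) _; move: xv; rewrite ler_pdivlMr// mulrC; apply: le_trans.
    by rewrite ler_wpM2r ?(rnorm_ge0 sf)// lerDl.
  by have := gx0 N; lra.
Qed.

End HyperinvariantSubspace.

(** * The method of minimal vectors in reflexive spaces *)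

Section MinimalVectorMethod.
Context {R : realType} {K : numFieldType} (i : {rmorphism R -> K}).
Context (sf : scalar_field i) (X : normedModType K) (Q : {linear X -> X}).
Context (cQ : continuous Q).
Local Notation rn := (rnorm i).

Lemma commutant_iter (T : {linear X -> X}) n x :
  commutant Q T -> T (iter n Q x) = iter n Q (T x).
Proof. by move=> [_ TQ]; elim: n => //= n IH; rewrite TQ IH. Qed.

Lemma reflexive_star_hyperinvariant :
  reflexive_space X -> (exists x, Q x <> 0) -> quasi_nilpotent Q ->
  property_star Q -> has_nontrivial_hyperinvariant_subspace Q.
Proof.
move=> refl Q0 qQ sQ.
have [dQ|/(closure_range_hyperinvariant sf Q0)//] :=
  pselect (forall z d, 0 < d -> exists y, rn (z - Q y) <= d).
have [C C0 QC] := linear_continuous_bounded sf (linear_coercion Q) cQ.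
have i2 : i 2^-1 = 2^-1 by rewrite fmorphV rmorph_nat.
have e01 : 0 < (2^-1 : R) < 1 by apply/andP; split; lra.
have [|x0 x01 star] := sQ 2^-1.
  by rewrite -i2 -(rmorph1 i) -{1}(rmorph0 i) !(emb_lt sf).
have {}x01 : rn x0 = 1.
  by apply: (fmorph_inj i); rewrite (rnormE sf) rmorph1 -normrN -[RHS]x01 sub0r.
have /choice[yg ygP] : forall n, exists yg : X * (X -> K^o),
    [/\ 0 < rn yg.1, rn (x0 - iter n Q yg.1) = 2^-1, linear yg.2,
        forall x, rn (yg.2 x) <= 2 * rn x &
        1 <= rn (yg.2 x0) /\ forall z, rn (yg.2 (iter n Q z)) <= 2 * rn z / rn yg.1].
  move=> n; have [y [g [h1 h2 h3 h4 h5]]] := minimal_vector sf (iter_linear Q n)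
    (iter_continuous sf cQ (n := n)) e01 x01 (iter_dense_range sf n C0 QC dQ).
  by exists (y, g); split=> //= x; rewrite -{1}[2]invrK.
pose y n := (yg n).1; pose g n := (yg n).2.
have ylow n : 2^-1 <= rn (iter n Q (y n)).
  have [_ h _ _ _] := ygP n.
  have : rn x0 <= rn (x0 - iter n Q (y n)) + rn (iter n Q (y n)).
    by rewrite -{1}(subrK (iter n Q (y n)) x0) rnormD.
  by rewrite x01 h => h1; lra.
have [m [mm mP]] : exists m : nat -> nat, {homo m : j k / (j < k)%N} /\
    forall k, rn (y (m k)) <= k.+1%:R^-1 * rn (y (m k).+1).
  apply: (@subsequence_exists (fun k n => rn (y n) <= k.+1%:R^-1 * rn (y n.+1))).
  by apply: (small_ratio sf cQ qQ) ylow; lra.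
pose x k := iter (m k) Q (y (m k)).
have xS k : rn (x0 - x k) = 2^-1 by have [_ h _ _ _] := ygP (m k).
have xb k : rn (x k) <= 1 + 2^-1.
  rewrite -[x k](subKr x0); apply: le_trans (rnormD sf _ _) _.
  by rewrite (rnormN sf) x01 xS.
have [s1 [s1m wx]] := reflexive_weak_subsequence sf refl xb.
have [|s2 [T [s2m cT TP Tcv]]] := star (x \o s1) _ wx.
  by move=> n; rewrite /sphere/= -(rnormE sf) xS.
pose s k := s1 (s2 k).
have T1 k v : rn (T k v) <= rn v.
  rewrite (rnorm_le sf) (rnormE sf).
  apply: le_trans (opnorm_bound sf v (linear_coercion (T k)) (cT k).1) _.
  by rewrite -[leRHS]mul1r ler_wpM2r// (TP k).1.
have Tx0 k : 3 / 4 <= rn (T k x0).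
  rewrite (rnorm_ge sf); apply: le_trans (TP k).2.
  have -> : (1 + 2^-1) / 2 = i ((1 + 2^-1) / 2) by rewrite rmorphM rmorphD rmorph1 i2.
  by rewrite (emb_le sf); lra.
pose w := lim ((fun k => T k (x (s k))) @ \oo).
have wP : forall e : R, 0 < e -> \forall k \near \oo, rn (T k (x (s k)) - w) <= e.
  exact: (cvg_rnorm sf _ _).1 Tcv.
(* The functional has index one higher than the power of [Q] in [x (s k)]: the additional [Q] in the
   asymptotic kernel supplies the missing power. *)
apply: (asymptotic_kernel_hyperinvariant sf cQ
  (g := fun k => g (m (s k)).+1) (C := 2) (x0 := x0) (w := w)) => //.
- by move=> k; have [] := ygP (m (s k)).+1.
- by move=> k; have [_ _ _ + _] := ygP (m (s k)).+1.
- by move=> k; have [_ _ _ _ []] := ygP (m (s k)).+1.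
(* If [w = 0], then [T N x0] has norm at most [1/2 + 1/8], below the [3/4] of property (star). *)
- move=> w0; have d40 : 0 < 8^-1 :> R by rewrite invr_gt0.
  have [N _ /(_ N (leqnn N))/=] := wP _ d40; rewrite w0 subr0 => TN.
  have : rn (T N x0) <= rn (T N (x0 - x (s N))) + rn (T N (x (s N))).
    by rewrite linearB -{1}(subrK (T N (x (s N))) (T N x0)) rnormD.
  have := T1 N (x0 - x (s N)); rewrite xS.
  by have := Tx0 N; lra.
move=> S cS d d0.
have cQS : continuous (Q \o S).
  by move=> z; apply: continuous_comp; [exact: cS.1|exact: cQ].
have [D D0 SD] := linear_continuous_bounded sf (linear_coercion S) cS.1.
have [E E0 QSE] := linear_continuous_bounded sf (linear_coercion (Q \o S)) cQS.
have d20 : 0 < d / 2 by rewrite divr_gt0.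
have E1 : 0 < 2 * E + 1 by rewrite ltr_wpDl// mulr_ge0.
have D1 : 0 < 2 * D + 1 by rewrite ltr_wpDl// mulr_ge0.
near=> k.
set G := g (m (s k)).+1; have [y0 _ lG GB [_ Gy]] := ygP (m (s k)).+1.
have GD u v : G (u + v) = G u + G v by have := lG 1 u v; rewrite !scale1r.
have -> : G (Q (S w)) = G (Q (S (w - T k (x (s k))))) + G (Q (S (T k (x (s k))))).
  by rewrite -GD -!linearD subrK.
rewrite [leRHS]splitr.
apply: le_trans (rnormD sf _ _) _; apply: lerD.
  apply: le_trans (GB _) _; apply: le_trans (_ : 2 * (E * rn (w - T k (x (s k)))) <= _).
    by rewrite ler_wpM2l//; exact: QSE.
  have : rn (T k (x (s k)) - w) <= d / 2 / (2 * E + 1).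
    by near: k; apply: wP; rewrite divr_gt0.
  rewrite -(rnormN sf) opprB ler_pdivlMr//; apply: le_trans.
  by rewrite mulrA [leLHS]mulrC ler_wpM2l ?(rnorm_ge0 sf)// lerDl.
(* Moving [S] and [T k] inside all powers exposes [m (s k) + 1] iterates of [Q], and the bound on
   [G] becomes a multiple of the ratio of consecutive minimal vectors. *)
rewrite commutant_iter// commutant_iter// -iterS.
apply: le_trans (Gy _) _; rewrite ler_pdivrMr//.
have yk : rn (S (T k (y (m (s k))))) <= D * rn (y (m (s k))).
  by apply: le_trans (SD _) _; rewrite ler_wpM2l.
(* The ratio is controlled by [1 / (s k + 1)], hence by [1 / (k + 1)], which tends to 0. *)
have ks : (k <= s k)%N.
  exact: leq_trans (subsequence_ge k s2m) (subsequence_ge (s2 k) s1m).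
have kd : (s k).+1%:R^-1 <= d / 2 / (2 * D + 1).
  apply: le_trans (_ : k.+1%:R^-1 <= _).
    by rewrite lef_pV2 ?posrE ?ltr0n// ler_nat ltnS.
  near: k; have dD : 0 < d / 2 / (2 * D + 1) by rewrite divr_gt0.
  have /cvgrPdist_le/(_ _ dD) := @cvg_harmonic R.
  by apply: filterS => n; rewrite sub0r normrN ger0_norm ?harmonic_ge0.
apply: le_trans (_ : 2 * D * ((s k).+1%:R^-1 * rn (y (m (s k)).+1)) <= _).
  rewrite -mulrA ler_wpM2l//; apply: le_trans yk _.
  by rewrite ler_wpM2l.
rewrite mulrA ler_wpM2r ?(rnorm_ge0 sf)//.
move: kd; rewrite ler_pdivlMr//; apply: le_trans.
by rewrite mulrC ler_wpM2l ?invr_ge0// lerDl.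
Unshelve. all: by end_near. Qed.

End MinimalVectorMethod.

(** * The theorem for real and complex scalars *)

Local Open Scope complex_scope.

Theorem theorem2p2 (R : realType) :
  (forall (X : completeNormedModType R) (Q : {linear X -> X}),
     continuous Q -> super_reflexive X -> (exists x : X, Q x <> 0) ->
     quasi_nilpotent Q -> property_star Q ->
     has_nontrivial_hyperinvariant_subspace Q) /\
  (forall (X : completeNormedModType R[i]) (Q : {linear X -> X}),
     continuous Q -> super_reflexive X -> (exists x : X, Q x <> 0) ->
     quasi_nilpotent Q -> property_star Q ->
     has_nontrivial_hyperinvariant_subspace Q).
Proof.
split=> X Q cQ /super_reflexive_reflexive reflX.
- exact: (reflexive_star_hyperinvariant (@real_scalar_field R)).
- exact: (reflexive_star_hyperinvariant (@complex_scalar_field R)).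
Qed.
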